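(* Let $g:[0,\infty)\to[0,\infty)$ be a function with tame superpolynomial growth (TSPG). Let $\Gamma$ be a group generated by a finite symmetric set $S=S^{-1}\subset\Gamma$ whose growth function satisfies $\gamma_S(r-1)\ge g(r)$ for every integer $r\ge 1$. Then for every $\varepsilon>0$ there exists $N=N(\varepsilon)\in\mathbb{N}$ such that $$\frac{|\partial_S D|}{|D|}\ \ge\ \frac{1-\varepsilon}{g^{-1}(|D|)}$$ for every finite subset $D\subset\Gamma$ with $|D|\ge N(\varepsilon)$.
   Context: A function $g:[0,\infty)\to[0,\infty)$ has tame superpolynomial growth (TSPG) if it is everywhere differentiable with $g'>0$ and $$\lim_{r\to\infty}\frac{r\,g'(r)\,g(\lambda r)}{g(r)^2}=\begin{cases}0 & \text{for every } 0<\lambda<1,\\ \infty & \text{for } \lambda=1.\end{cases}$$ Such a $g$ is strictly increasing and unbounded, so $g^{-1}(t)$ is defined for all $t\ge g(0)$. For an integer $r\ge 0$, $B_S(r)\subset\Gamma$ is the set of elements that can be written as a product of at most $r$ elements of $S$ (so $B_S(0)=\{e\}$), and $\gamma_S(r)=|B_S(r)|$. The (inner) boundary of $D\subset\Gamma$ is $\partial_S D=\{x\in D : \exists s\in S,\ sx\notin D\}$. *)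

(* Defs.v *)
From HB Require Import structures.
From mathcomp Require Import all_boot all_order all_algebra finmap.
From mathcomp Require Import all_classical all_reals all_analysis.

Set Implicit Arguments.
Unset Strict Implicit.
Unset Printing Implicit Defensive.

Import Order.TTheory GRing.Theory Num.Theory.
Import numFieldNormedType.Exports.

Local Open Scope classical_set_scope.
Local Open Scope ring_scope.

(* A function g : [0, +oo) -> [0, +oo) is represented by g : R -> R; no
   definition below depends on the values of g at negative arguments. *)

(* The increments h are restricted to 0 <= x + h, so that the derivative at 0 is
   one-sided; at x > 0 it is the usual derivative (ray_deriveE). *)
Definition ray_diffquot (R : realType) (g : R -> R) (x : R) : set_system R :=
  h^-1 * (g (x + h) - g x) @[h --> within [set h | 0 <= x + h] (0 : R)^'].

Definition ray_derivable (R : realType) (g : R -> R) (x : R) : Prop :=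
  cvg (ray_diffquot g x).

Definition ray_derive (R : realType) (g : R -> R) (x : R) : R :=
  lim (ray_diffquot g x).

Definition tspg_ratio (R : realType) (g : R -> R) (lambda r : R) : R :=
  r * ray_derive g r * g (lambda * r) / g r ^+ 2.

Definition tspg (R : realType) (g : R -> R) : Prop :=
  [/\ forall x, 0 <= x -> 0 <= g x,
      forall x, 0 <= x -> ray_derivable g x /\ 0 < ray_derive g x,
      forall lambda, 0 < lambda -> lambda < 1 ->
        tspg_ratio g lambda r @[r --> +oo] --> (0 : R)
    & tspg_ratio g 1 r @[r --> +oo] --> +oo].

(* Inverse of g : [0, +oo) -> g([0, +oo)), with junk value 0 elsewhere. *)
Definition ray_inv (R : realType) (g : R -> R) : R -> R :=
  'pinv_(fun=> 0) `[0, +oo[ g.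

Definition generates (G : groupType) (S : {fset G}) : Prop :=
  forall H : {pred G}, group_closed H -> {subset S <= H} -> forall x, x \in H.

Definition ball_S (G : groupType) (S : {fset G}) (r : nat) : set G :=
  [set x | exists w : seq G,
     [/\ (size w <= r)%N, {subset w <= S} & x = (\big[*%g/1%g]_(s <- w) s)]].

(* fset_set A is fset0 when A is infinite; balls are finite (finite_ball_S). *)
Definition growth (G : groupType) (S : {fset G}) (r : nat) : nat :=
  #|` fset_set (ball_S S r) |.

Definition boundary (G : groupType) (S D : {fset G}) : {fset G} :=
  [fset x in D | has (fun s => (s * x)%g \notin D) S]%fset.

Lemma finite_ball_S (G : groupType) (S : {fset G}) (r : nat) :
  finite_set (ball_S S r).
Proof.
elim: r => [|r IH].
  apply: (sub_finite_set _ (finite_set1 (1%g : G))) => x [w [+ _ ->]].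
  by rewrite leqn0 size_eq0 => /eqP ->; rewrite big_nil.
apply: (@sub_finite_set _ _ (ball_S S r `|`
    [set (s * x)%g | s in [set` S] & x in ball_S S r])).
  move=> x [[|s w] [sw Sw ->]]; first by left; exists [::]; split.
  right; exists s => /=; first by apply: Sw; rewrite mem_head.
  exists (\big[*%g/1%g]_(t <- w) t); last by rewrite big_cons.
  by exists w; split=> // t tw; apply: Sw; rewrite in_cons tw orbT.
by rewrite finite_setU; split=> //; apply: finite_image2 => //; exact: finite_fset.
Qed.

Lemma ray_deriveE (R : realType) (g : R -> R) (x : R) :
  0 < x -> ray_derive g x = derive1 g x.
Proof.
move=> x0; rewrite /ray_derive /ray_diffquot derive1E /derive.
have -> : within [set h | 0 <= x + h] (0 : R)^' = (0 : R)^'.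
  apply/seteqP; split=> A; rewrite /within /=; last first.
    by move=> AF; apply: filterS AF => h Ah _.
  move=> AH; near=> h.
  have Ah : 0 <= x + h -> A h by near: h.
  apply: Ah; have : `|h| < x by near: h; exact: dnbhs0_lt.
  by rewrite ltr_norml => /andP[h1 _]; rewrite -lerBlDl sub0r ltW.
suff -> : (fun h => h^-1 * (g (x + h) - g x)) =
          (fun h => h^-1 *: ((g \o shift x) (h *: 1) - g x)) by [].
by apply/funext => h /=; rewrite [h *: 1]mulr1 (addrC h).
Unshelve. all: by end_near.
Qed.

(* Main.v *)
(* If x = s_k ... s_1 has length k <= n, every y in D with x y outside D has a
   first step s_i ... s_1 y in the boundary from which it leaves D, and for fixed
   i this step determines y; hence x moves at most n |bd D| points of D out of D.
   At most |D| elements x keep a given y inside D, so summing over the ball B(n)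
   gives |B(n)| |D| <= |D|^2 + n |B(n)| |bd D|.  Put rho := g^-1(|D|) and
   n := floor ((1 + d) rho).  Then |B(n)| >= g (n + 1) >= g ((1 + d) rho), and
   since x g'(x) / g(x) --> +oo this exceeds g(rho) / d = |D| / d once rho is
   large.  Therefore |bd D| / |D| >= (1 - d) / ((1 + d) rho)
   >= (1 - 2 d) / rho. *)
Require Import Defs.
From HB Require Import structures.
From mathcomp Require Import all_boot all_order all_algebra finmap.
From mathcomp Require Import all_classical all_reals all_analysis.
From mathcomp Require Import ring lra.

Import Order.TTheory GRing.Theory Num.Theory.
Import numFieldNormedType.Exports.

Local Open Scope ring_scope.

(** * Counting the points that left translations move out of a finite set *)

Section EscapingTranslates.
Variables (G : groupType) (S D : {fset G}).

Lemma card_mul_sum (A : {fset G}) (k : nat) :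
  (#|` A| * k = \sum_(x <- A) k)%N.
Proof. by rewrite big_const_seq count_predT iter_addn_0 mulnC. Qed.

Definition escape (x : G) : nat := count (fun y => (x * y)%g \notin D) D.

(** If [s * x] moves [y] out of [D], either [x * y] is already outside, or [x * y] is a boundary
    point, and it determines [y]. *)
Lemma escape_gen_mul (s x : G) : s \in S ->
  (escape (s * x)%g <= #|` boundary S D| + escape x)%N.
Proof.
move=> sS; rewrite /escape -!size_filter.
set A := [seq y <- D | (x * y)%g \notin D].
set B := [seq y <- D | ((x * y)%g \in D) && ((s * (x * y))%g \notin D)].
have sizeB : (size B <= #|` boundary S D|)%N.
  rewrite -(size_map (fun y => (x * y)%g)); apply: uniq_leq_size.
    by rewrite map_inj_uniq ?filter_uniq ?fset_uniq//; apply: mulgI.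
  move=> _ /mapP[y + ->]; rewrite mem_filter => /andP[/andP[xyD sxyD] _].
  by rewrite /boundary !inE xyD; apply/hasP; exists s.
apply: leq_trans _ (leq_add sizeB (leqnn _)); rewrite -size_cat.
apply: uniq_leq_size; first by rewrite filter_uniq ?fset_uniq.
move=> y; rewrite mem_cat !mem_filter -mulgA => /andP[-> ->].
by rewrite !andbT orbN.
Qed.

Lemma escape_ball (n : nat) (x : G) : ball_S S n x ->
  (escape x <= n * #|` boundary S D|)%N.
Proof.
case=> w [wn wS ->]; apply: leq_trans _ (leq_mul wn (leqnn _)).
elim: w wS {wn} => [|s w IH] wS.
  rewrite big_nil leqn0 /escape -leqn0 leqNgt -has_count -all_predC.
  by apply/allP => y yD /=; rewrite mul1g negbK.
rewrite big_cons mulSn; apply: leq_trans (escape_gen_mul _ _ _) _.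
  by apply: wS; rewrite mem_head.
by rewrite leq_add2l IH// => t tw; apply: wS; rewrite in_cons tw orbT.
Qed.

(* Double counting of the pairs (x, y) in B x D with x y in D: each y accounts
   for at most |D| of them. *)
Lemma sum_escape_ge (B : {fset G}) :
  (#|` B| * #|` D| <= #|` D| * #|` D| + \sum_(x <- B) escape x)%N.
Proof.
have stay y : (count (fun x => (x * y)%g \in D) B <= #|` D|)%N.
  rewrite -size_filter -(size_map (fun x => (x * y)%g)).
  apply: uniq_leq_size.
    by rewrite map_inj_uniq ?filter_uniq ?fset_uniq//; apply: mulIg.
  by move=> _ /mapP[x + ->]; rewrite mem_filter => /andP[].
have sumB (a : pred G) (s : seq G) : (count a s = \sum_(x <- s) a x)%N.
  by rewrite -sum1_count big_mkcond.
have -> : (#|` B| * #|` D| =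
    \sum_(x <- B) count (fun y => (x * y)%g \in D) D
    + \sum_(x <- B) escape x)%N.
  rewrite card_mul_sum -big_split /=; apply: eq_bigr => x _.
  by rewrite -(count_predC (fun y => (x * y)%g \in D)).
rewrite leq_add2r.
under eq_bigr do rewrite sumB.
rewrite exchange_big /= card_mul_sum; apply: leq_sum => y _.
by rewrite -sumB.
Qed.

Lemma boundary_growth (n : nat) :
  (growth S n * #|` D|
    <= #|` D| * #|` D| + growth S n * (n * #|` boundary S D|))%N.
Proof.
apply: leq_trans (sum_escape_ge _) _; rewrite leq_add2l /growth.
rewrite card_mul_sum big_seq [leqRHS]big_seq.
apply: leq_sum => x; rewrite in_fset_set ?inE; last exact: finite_ball_S.
exact: escape_ball.
Qed.

End EscapingTranslates.

(** * Calculus and inversion of functions of tame superpolynomial growth *)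

Section TameGrowth.
Variables (R : realType) (g : R -> R).
Hypothesis g_tspg : tspg g.

(** At [x > 0] all small [h] satisfy [0 <= x + h], so the limit along the ray is two-sided and the
    mean value theorem applies away from 0. *)
Lemma tspg_is_derive (x : R) : 0 < x -> is_derive x 1 g (ray_derive g x).
Proof.
move=> x0; case: g_tspg => _ /(_ x (ltW x0))[dg _] _ _.
suff dx : derivable g x 1.
  by rewrite ray_deriveE// derive1E; exact: derivableP.
have /cvg_ex[l dl] := dg; apply/cvg_ex; exists l.
have -> : (fun h => h^-1 *: ((g \o shift x) (h *: 1) - g x)) =
          (fun h => h^-1 * (g (x + h) - g x)).
  by apply/funext => h /=; rewrite [h *: 1]mulr1 (addrC h).
apply: cvg_trans dl => A AH.
have {}AH : \forall h \near (0 : R)^'%classic,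
    0 <= x + h -> A (h^-1 * (g (x + h) - g x)) by exact: AH.
change (\forall h \near (0 : R)^'%classic, A (h^-1 * (g (x + h) - g x))).
near=> h.
have Ah : 0 <= x + h -> A (h^-1 * (g (x + h) - g x)) by near: h.
apply: Ah; have : `|h| < x by near: h; exact: dnbhs0_lt.
by rewrite ltr_norml => /andP[h1 _]; rewrite -lerBlDl sub0r ltW.
Unshelve. all: by end_near.
Qed.

Lemma tspg_continuous (a b : R) : 0 < a -> {within `[a, b], continuous g}%classic.
Proof.
move=> a0; apply: derivable_within_continuous => x.
rewrite in_itv/= => /andP[ax _].
by have [] := tspg_is_derive _ (lt_le_trans a0 ax).
Qed.

Lemma tspg_MVT (a b : R) : 0 < a -> a < b ->
  exists c, [/\ a < c, c < b & g b - g a = ray_derive g c * (b - a)].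
Proof.
move=> a0 ab; have dg x : x \in `]a, b[ -> is_derive x 1 g (ray_derive g x).
  by rewrite in_itv/= => /andP[ax _]; exact: tspg_is_derive (lt_trans a0 ax).
have [c] := MVT ab dg (tspg_continuous a b a0).
by rewrite in_itv/= => /andP[ac cb] E; exists c.
Qed.

Lemma tspg_lt (a b : R) : 0 < a -> a < b -> g a < g b.
Proof.
move=> a0 ab; have [c [ac _ E]] := tspg_MVT _ _ a0 ab.
rewrite -subr_gt0 E mulr_gt0 ?subr_gt0//.
by have [_ dg _ _] := g_tspg; have [] := dg c (ltW (lt_trans a0 ac)).
Qed.

Lemma tspg_le (a b : R) : 0 < a -> a <= b -> g a <= g b.
Proof.
by move=> a0; rewrite le_eqVlt => /predU1P[->//|ab]; exact/ltW/tspg_lt.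
Qed.

Lemma tspg_gt0 (x : R) : 0 < x -> 0 < g x.
Proof.
(* The comparison point is [x / 2] and not 0, since [tspg_lt] covers positive arguments only. *)
move=> x0; have x20 : 0 < x / 2 by rewrite divr_gt0.
have [g_ge0 _ _ _] := g_tspg; apply: le_lt_trans (g_ge0 _ (ltW x20)) _.
by apply: tspg_lt => //; lra.
Qed.

(* The limit at lambda = 1 says that the logarithmic derivative of g with
   respect to log x tends to infinity. *)
Lemma tspg_superpolynomial (d K : R) : 0 < d -> 0 < K ->
  exists2 A, 0 < A & forall x, A <= x -> K * g x <= g ((1 + d) * x).
Proof.
(* The factor [(1 + d) / d] offsets [c < (1 + d) * x] at the mean value point [c]: the increment
   [d * x * g'(c)] is then at least [K * g c]. *)
move=> d0 K0; have [_ _ _ /cvgryPge/(_ (K * (1 + d) / d))] := g_tspg.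
move=> [A [_ HA]]; exists (Num.max 1 A); first by rewrite lt_max ltr01.
move=> x; rewrite ge_max => /andP[x1 Ax].
have x0 : 0 < x by lra.
have xdx : x < (1 + d) * x by rewrite ltr_pMl// ltrDl.
have [c [xc cb E]] := tspg_MVT _ _ x0 xdx.
have c0 : 0 < c by lra.
have gx0 := tspg_gt0 _ x0; have gc0 := tspg_gt0 _ c0.
have /HA := le_lt_trans Ax xc; rewrite /tspg_ratio mul1r.
have -> : c * ray_derive g c * g c / g c ^+ 2 = c * ray_derive g c / g c.
  by field; rewrite gt_eqF.
rewrite ler_pdivlMr// mulrAC ler_pdivrMr// => Hc.
set p := ray_derive g c in E Hc.
have p0 : 0 < p by have [_ dg _ _] := g_tspg; have [] := dg c (ltW c0).
have Kgc : K * g c <= d * p * x.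
  rewrite -(ler_pM2r (_ : 0 < 1 + d)); last by lra.
  have : d * p * c <= d * p * ((1 + d) * x).
    by rewrite ler_wpM2l ?mulr_ge0// ltW.
  lra.
have KgxKgc : K * g x <= K * g c by rewrite ler_pM2l// ltW// tspg_lt.
rewrite (_ : p * _ = d * p * x) in E; last by ring.
lra.
Qed.

Lemma tspg_unbounded (a y : R) : 0 < a -> exists2 b, a < b & y <= g b.
Proof.
move=> a0; have ga0 := tspg_gt0 _ a0.
(* With this factor [K] and [M = max a A], [g (2 * M) >= K * g M >= K * g a = |y| + 1]. *)
have K0 : 0 < (`|y| + 1) / g a by rewrite divr_gt0// ltr_wpDl.
have [A _ HA] := tspg_superpolynomial _ _ ltr01 K0.
have aM : a <= Num.max a A by rewrite le_max lexx.
exists ((1 + 1) * Num.max a A); first lra.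
have AM : A <= Num.max a A by rewrite le_max lexx orbT.
apply: le_trans (HA _ AM); rewrite mulrAC ler_pdivlMr//.
have := ler_norm y; have := normr_ge0 y.
have := tspg_le _ _ a0 aM; nra.
Qed.

Lemma tspg_ray_inv (a y : R) : 0 < a -> g 0 < y -> g a <= y ->
  a <= ray_inv g y /\ g (ray_inv g y) = y.
Proof.
move=> a0 g0y gay; have [b ab yb] := tspg_unbounded a y a0.
have [c cab gc] : exists2 c, c \in `[a, b] & g c = y.
  apply: IVT (ltW ab) (tspg_continuous _ _ a0) _.
  by rewrite ge_min gay le_max yb orbT.
(* Membership in the image ensures that [ray_inv g y] is a true preimage and not the default value
   0. *)
have y_img : y \in (g @` `[0, +oo[)%classic.
  rewrite inE; exists c => //=; move: cab.
  by rewrite !in_itv/= andbT => /andP[ac _]; lra.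
have grho : g (ray_inv g y) = y by exact: pinvK.
have rho_ge0 : 0 <= ray_inv g y.
  have : (`[0, +oo[%classic : set R) (ray_inv g y).
    apply: (surjpinv_image_sub (B := (g @` `[0, +oo[)%classic) (f := g)) => //.
    by exists y; first exact: set_mem y_img.
  by rewrite /= in_itv/= andbT.
split=> //; rewrite leNgt; apply/negP => rho_lt.
(* The value 0, out of reach of [tspg_lt], is excluded by [g 0 < y]. *)
move: rho_ge0; rewrite le_eqVlt => /predU1P[rho0|rho0].
  by move: g0y; rewrite -grho -rho0 ltxx.
by have := tspg_lt _ _ rho0 rho_lt; rewrite grho ltNge gay.
Qed.

End TameGrowth.

Theorem corollary3p11 (R : realType) (g : R -> R) (G : groupType)
    (S : {fset G})
    (g_tspg : tspg g)
    (S_sym : S = [fset (s^-1)%g | s in S]%fset)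
    (S_gen : generates S)
    (S_growth : forall r : nat, (1 <= r)%N -> g r%:R <= (growth S r.-1)%:R)
    (eps : R) (eps_gt0 : 0 < eps) :
  exists N : nat, forall D : {fset G}, (N <= #|` D|)%N ->
    (1 - eps) / ray_inv g (#|` D|)%:R
      <= (#|` boundary S D|)%:R / (#|` D|)%:R.
Proof.
(* Half of [eps] suffices because [(1 - 2 * d) * (1 + d) <= 1 - d]. *)
have [d d0 deps] : exists2 d, 0 < d & eps = 2 * d by exists (eps / 2); lra.
have [|A A0 HA] := tspg_superpolynomial _ _ g_tspg d d^-1 d0.
  by rewrite invr_gt0.
(* This makes [|D|] exceed both [g 0] and [g A], so that its inverse image is at least [A]. *)
exists (Num.trunc (Num.max (g 0) (g A))).+1 => D ND.
have gy : Num.max (g 0) (g A) < (#|` D|)%:R.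
  by apply: lt_le_trans (truncnS_gt _) _; rewrite ler_nat.
move: gy; rewrite gt_max => /andP[g0y /ltW gAy].
have [] := tspg_ray_inv _ _ g_tspg A _ A0 g0y gAy.
move: (ray_inv _ _) => rho Arho grho.
have rho0 : 0 < rho by lra.
have y0 : 0 < (#|` D|)%:R :> R by rewrite -grho; exact: tspg_gt0.
have r_ge0 : 0 <= (1 + d) * rho by rewrite mulr_ge0//; lra.
set n := Num.trunc ((1 + d) * rho).
have n_le : n%:R <= (1 + d) * rho by rewrite truncn_le.
have growth_ge : (#|` D|)%:R <= d * (growth S n)%:R :> R.
  rewrite -ler_pdivrMl// -grho (le_trans (HA _ Arho))//.
  (* Radius [n] is paired with [g (n + 1)], and [n + 1 > (1 + d) * rho], so rounding down loses
     nothing. *)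
  apply: le_trans (S_growth n.+1 isT); apply: tspg_le => //.
    by rewrite mulr_gt0//; lra.
  exact/ltW/truncnS_gt.
have := boundary_growth _ S D n.
rewrite -(ler_nat R) natrD !natrM.
move: (growth S n)%:R (#|` boundary S D|)%:R (ler0n R #|` boundary S D|) growth_ge.
move: (#|` D|)%:R y0 => y y0 gam b b0 ygam main.
have gam0 : 0 < gam by nra.
(* Since [y * y <= d * gam * y], the ball size [gam] cancels. *)
have {}main : y * (1 - d) <= (1 + d) * rho * b.
  rewrite -(ler_pM2l gam0).
  have : n%:R * b <= (1 + d) * rho * b by rewrite ler_wpM2r.
  nra.
rewrite ler_pdivrMr// mulrAC ler_pdivlMr//.
rewrite -(ler_pM2l (_ : 0 < 1 + d)); last by lra.
nra.
Qed.
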